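(* Let $n\ge 4$ be an integer. If $x:C_n\to\mathbb R$ satisfies $x_j\ge 0$ for all $j\in C_n$ and $\langle x^2\rangle=1$, then $$D(x)\ \ge\ \frac{2\lambda_n}{3}\,\big\langle (x-1)^2(x+2)\big\rangle .$$
   Context: Let $C_n:=\mathbb Z/n\mathbb Z$ be the $n$-cycle. Functions $x:C_n\to\mathbb R$ are written $x=(x_j)_{j\in C_n}$, with indices taken modulo $n$; products, powers and sums with constants are pointwise. The normalized average is $\langle x\rangle:=\frac1n\sum_{j\in C_n}x_j$. Set $$D(x):=\big\langle (x_j-x_{j+1})^2\big\rangle=\frac1n\sum_{j\in C_n}(x_j-x_{j+1})^2 .$$ The spectral gap is $$\lambda_n:=\inf_{f:\,\operatorname{Var}(f)>0}\frac{\frac12 D(f)}{\operatorname{Var}(f)},\qquad \operatorname{Var}(f):=\langle f^2\rangle-\langle f\rangle^2,$$ where the infimum is over functions $f:C_n\to\mathbb R$. (A standard Fourier computation gives $\lambda_n=1-\cos\frac{2\pi}{n}$.) *)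

(* Defs.v *)
(* MathComp world, with the real numbers of MathComp-Analysis. *)
From HB Require Import structures.
From mathcomp Require Import all_boot all_order all_algebra.
From mathcomp Require Import boolp classical_sets reals.

Set Implicit Arguments.
Unset Strict Implicit.
Unset Printing Implicit Defensive.

Import Order.TTheory GRing.Theory Num.Theory.
Local Open Scope classical_set_scope.
Local Open Scope ring_scope.

(* The cycle C_n is the type 'Z_n, which has n elements only when 1 < n;
   j + 1 is then the successor modulo n.  The definitions below are meant
   under that condition. *)

Definition avg {R : realType} n (x : 'Z_n -> R) : R :=
  n%:R^-1 * \sum_(j : 'Z_n) x j.
Arguments avg {R} n x.

Definition dirichlet (R : realType) n (x : 'Z_n -> R) : R :=
  avg n (fun j => (x j - x (j + 1)) ^+ 2).
Arguments dirichlet {R} n x.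

Definition variance (R : realType) n (f : 'Z_n -> R) : R :=
  avg n (fun j => f j ^+ 2) - avg n f ^+ 2.
Arguments variance {R} n f.

(* [inf] is a junk value on sets that are empty or not bounded below; for
   1 < n the set here is nonempty and bounded below by 0. *)
Definition spectral_gap (R : realType) (n : nat) : R :=
  inf [set 2^-1 * dirichlet n f / variance n f
      | f in [set f : 'Z_n -> R | 0 < variance n f]].

(* Main.v *)
Require Import Defs.
From HB Require Import structures.
From mathcomp Require Import all_boot all_order all_algebra.
From mathcomp Require Import boolp classical_sets reals trigo.
From mathcomp Require Import zify ring lra.

Import Order.TTheory GRing.Theory Num.Theory.
Local Open Scope ring_scope.

(** The quantity to control is [avg x^3 - 3 avg x + 2], and [spectral_gap]
    may be replaced by its upper bound [mu := 1 - cos (2 pi / n)]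
    ([spectral_gap_le]), because [(x - 1)^2 (x + 2) >= 0].

    Write [x = a + f + w], where [a] is the mean, [f] the component of [x] on
    the frequencies [1] and [n - 1], and [w] the rest; let [t] and [q] be the
    averages of [f^2] and [w^2], so that [a^2 + t + q = 1].  Parseval gives
    [dirichlet x = 2 mu (t + q) + 2 E], where [E] is the sum of
    [(cos (2 pi / n) - cos (2 pi k / n)) |x^(k)|^2] over [2 <= k <= n - 2]
    ([dirichlet_split]).  Writing [E = mu e], the goal becomes
      [avg x^3 - 3 a + 2 <= 3 (t + q + e)],
    which, [a^3 + 3 a (t + q)] being the trivial part of [avg x^3], says that
      [3 avg (f^2 w) + 3 avg (f w^2) + avg w^3 <= 3 e + (1 - a)^2 (1 + 2 a)].
    The term [avg f^3] has disappeared, because three frequencies [1] or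
    [n - 1] cannot add up to [0] modulo [n] when [n >= 4]; for [n = 3] the
    inequality is false.

    For [n >= 5] there is enough room for crude bounds.  The function
    [g := f^2 - t] has pure frequency [2], so that [avg g^2 = t^2 / 2] and
    [avg (f^2 w) = avg (g w)] is at most [t^2 / 4 + q / 2]; moreover
    [f^2 <= 2 t] pointwise.  Two facts control [w] by its energy:
    [8 / 5 q <= e], since the second eigenvalue is well above the first
    ([high_energy_gap]), and [w^2 <= 2 e] pointwise, by Cauchy-Schwarz and
    the telescoping sum of the inverses of [cos (2 pi / n) - cos (2 pi k / n)]
    ([high_sup]).  Together with [(1 - a)^2 (1 + 2 a) >= 3/4 (1 - a^2)^2] these
    reduce the claim to an inequality between four real numbers
    ([energy_beats_cubic]).

    For [n = 4] the function [g] may be as large as [t], and the inequality is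
    sharp to fourth order at [x = 1].  There [w] is a multiple [s] of the
    alternating function, [avg (f w^2) = avg w^3 = 0], and an explicit sum of
    nonnegative terms settles it ([cubic_le_dirichlet4]). *)

(** * Averages over the cycle *)

Lemma avgE (R : realType) n (F : nat -> R) : (1 < n)%N ->
  avg n (fun j => F j) = n%:R^-1 * \sum_(0 <= j < n) F j.
Proof. by move=> n1; rewrite /avg -(big_mkord xpredT F) Zp_cast. Qed.

Lemma avgD (R : realType) n (x y : 'Z_n -> R) :
  avg n (fun j => x j + y j) = avg n x + avg n y.
Proof. by rewrite /avg big_split mulrDr. Qed.

Lemma avgZ (R : realType) n (c : R) (x : 'Z_n -> R) :
  avg n (fun j => c * x j) = c * avg n x.
Proof. by rewrite /avg -mulr_sumr mulrCA. Qed.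

Lemma avg_cst (R : realType) n (c : R) : (1 < n)%N ->
  avg n (fun=> c) = c.
Proof.
move=> n1; rewrite /avg sumr_const card_ord Zp_cast // -(mulr_natl c) mulKf //.
by rewrite pnatr_eq0; case: n n1.
Qed.

Lemma avg_sum (R : realType) n m p (X : nat -> 'Z_n -> R) :
  avg n (fun j => \sum_(m <= k < p) X k j) = \sum_(m <= k < p) avg n (X k).
Proof. by rewrite /avg exchange_big mulr_sumr. Qed.

Lemma eq_avg (R : realType) n (x y : 'Z_n -> R) : x =1 y -> avg n x = avg n y.
Proof. by move=> /funext ->. Qed.

Lemma le_avg (R : realType) n (x y : 'Z_n -> R) :
  (forall j, x j <= y j) -> avg n x <= avg n y.
Proof. by move=> xy; rewrite ler_wpM2l ?invr_ge0// ler_sum. Qed.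

Lemma avg_ge0 (R : realType) n (x : 'Z_n -> R) :
  (forall j, 0 <= x j) -> 0 <= avg n x.
Proof. by move=> x0; rewrite mulr_ge0 ?invr_ge0// sumr_ge0. Qed.

Lemma avg_shift (R : realType) n (x : 'Z_n -> R) :
  avg n (fun j => x (j + 1)) = avg n x.
Proof.
by rewrite /avg [in RHS](reindex_inj (addIr (1 : 'Z_n))).
Qed.

(** * Trigonometric sums over whole turns *)

Definition turn (R : realType) n : R := pi *+ 2 / n%:R.

Lemma turn_mul (R : realType) n m : (1 < n)%N ->
  turn R n * (m * n)%:R = pi *+ 2 *+ m.
Proof.
move=> n1; rewrite /turn natrM -[RHS]mulr_natr; field.
by rewrite pnatr_eq0; case: n n1.
Qed.

Lemma cos_turnD (R : realType) n m (a : R) : (1 < n)%N ->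
  cos (a + turn R n * (m * n)%:R) = cos a.
Proof. by move=> n1; rewrite turn_mul// (periodicn (@cosD2pi R)). Qed.

Lemma sin_turnD (R : realType) n m (a : R) : (1 < n)%N ->
  sin (a + turn R n * (m * n)%:R) = sin a.
Proof. by move=> n1; rewrite turn_mul// (periodicn (@sinD2pi R)). Qed.

Lemma sin_half_turn_gt0 (R : realType) n m : (0 < m < n)%N ->
  0 < sin (turn R n * m%:R / 2).
Proof.
move=> /andP[m0 mn]; apply: sin_gt0_pi.
have n0 : (0 : R) < n%:R by rewrite ltr0n (leq_trans _ mn).
have -> : turn R n * m%:R / 2 = pi * (m%:R / n%:R).
  by rewrite /turn -[pi *+ 2]mulr_natl; field; rewrite gt_eqF.
have pi0 := pi_gt0 R; apply/andP; split.
  by rewrite mulr_gt0 ?divr_gt0 ?ltr0n ?(leq_trans _ mn).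
by rewrite gtr_pMr// ltr_pdivrMr// mul1r ltr_nat.
Qed.

(** Multiplying by [2 sin (b / 2)] turns each cosine into a difference of two
    sines at consecutive half-steps. *)
Lemma sum_cos_telescope (R : realType) (n : nat) (b a : R) :
  2 * sin (b / 2) * \sum_(0 <= k < n) cos (b * k%:R + a)
  = sin (b * n%:R - b / 2 + a) - sin (a - b / 2).
Proof.
elim: n => [|n IH].
  by rewrite big_geq// !mulr0 add0r [- _ + _]addrC subrr.
rewrite big_nat_recr//= mulrDr IH -(natr1 n).
have -> : b * (n%:R + 1) - b / 2 + a = (b * n%:R + a) + b / 2 by lra.
have -> : b * n%:R - b / 2 + a = (b * n%:R + a) - b / 2 by lra.
rewrite (sinB (b * n%:R + a)) (sinD (b * n%:R + a)); ring.
Qed.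

(** The phase [a] makes the sine version a special case. *)
Lemma sum_cos_turn (R : realType) n m (a : R) : (0 < m < n)%N ->
  \sum_(0 <= k < n) cos (turn R n * (m * k)%:R + a) = 0.
Proof.
move=> mn; have n1 : (1 < n)%N by case/andP: mn; case: n m => [|[|n]] [|m].
have /eqP := sum_cos_telescope R n (turn R n * m%:R) a.
have -> : turn R n * m%:R * n%:R - turn R n * m%:R / 2 + a
  = (a - turn R n * m%:R / 2) + turn R n * (m * n)%:R by rewrite natrM; lra.
rewrite sin_turnD// subrr mulf_eq0 mulf_eq0 pnatr_eq0/=.
rewrite gt_eqF ?sin_half_turn_gt0//= => /eqP sum0.
by rewrite -[RHS]sum0; apply: eq_bigr => k _; rewrite natrM mulrA.
Qed.

Lemma sum_sin_turn (R : realType) n m (a : R) : (0 < m < n)%N ->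
  \sum_(0 <= k < n) sin (turn R n * (m * k)%:R + a) = 0.
Proof.
move=> mn; rewrite -[RHS](sum_cos_turn R n m (a - pi / 2) mn).
by apply: eq_bigr => k _; rewrite addrA cosBpihalf.
Qed.

(** * Fourier analysis on the cycle *)

Lemma Zp_succ n (j : 'Z_n) : (1 < n)%N -> (j + 1 : 'Z_n) = (j.+1 %% n)%N :> nat.
Proof. by move=> n1; rewrite /= modnDmr addn1; congr (_ %% _)%N; exact: Zp_cast. Qed.

Lemma cos_turn_succ (R : realType) n k (j : 'Z_n) : (1 < n)%N ->
  cos (turn R n * (k * (j + 1 : 'Z_n)%R)%:R)
  = cos (turn R n * (k * j)%:R + turn R n * k%:R).
Proof.
move=> n1; rewrite Zp_succ// -(cos_turnD R n (k * (j.+1 %/ n)))// -!mulrDr -!natrD.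
by congr (cos (_ * _%:R)); rewrite -mulnA -mulnDr addnC -divn_eq mulnS addnC.
Qed.

Lemma sin_turn_succ (R : realType) n k (j : 'Z_n) : (1 < n)%N ->
  sin (turn R n * (k * (j + 1 : 'Z_n)%R)%:R)
  = sin (turn R n * (k * j)%:R + turn R n * k%:R).
Proof.
move=> n1; rewrite Zp_succ// -(sin_turnD R n (k * (j.+1 %/ n)))// -!mulrDr -!natrD.
by congr (sin (_ * _%:R)); rewrite -mulnA -mulnDr addnC -divn_eq mulnS addnC.
Qed.

Definition wave (R : realType) n (k : nat) (A B : R) (j : nat) : R :=
  A * cos (turn R n * (k * j)%:R) + B * sin (turn R n * (k * j)%:R).

(** With [fsin], minus the imaginary part, this is the real part of the [k]-th
    Fourier coefficient of [x]. *)
Definition fcos (R : realType) n (x : 'Z_n -> R) (k : nat) : R :=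
  avg n (fun j : 'Z_n => x j * cos (turn R n * (k * j)%:R)).

Definition fsin (R : realType) n (x : 'Z_n -> R) (k : nat) : R :=
  avg n (fun j : 'Z_n => x j * sin (turn R n * (k * j)%:R)).

Definition power (R : realType) n (x : 'Z_n -> R) (k : nat) : R :=
  fcos R n x k ^+ 2 + fsin R n x k ^+ 2.

Lemma avg_mul_wave (R : realType) n (x : 'Z_n -> R) k (A B : R) :
  avg n (fun j => x j * wave R n k A B j) = A * fcos R n x k + B * fsin R n x k.
Proof.
by rewrite /fcos /fsin -!avgZ -avgD; apply: eq_avg => j; rewrite /wave; ring.
Qed.

Lemma sum_cos_diff (R : realType) n i j : (i < n)%N -> (j < n)%N ->
  \sum_(0 <= k < n) cos (turn R n * (k * i)%:R - turn R n * (k * j)%:R)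
  = n%:R *+ (i == j).
Proof.
wlog ji : i j / (j <= i)%N => [H|].
  have [/H//|/ltnW/H {}H] := leqP j i; move=> ? ?; rewrite eq_sym -H//.
  by apply: eq_bigr => k _; rewrite -cosN opprB.
move=> n_i n_j; have [->|nij] := eqVneq i j.
  under eq_bigr do rewrite subrr cos0.
  by rewrite sumr_const_nat subn0.
rewrite mulr0n -[RHS](sum_cos_turn R n (i - j) 0).
  apply: eq_bigr => k _; rewrite -mulrBr -natrB ?leq_mul2l ?ji ?orbT// addr0.
  by rewrite -mulnBr mulnC.
by rewrite subn_gt0 ltn_neqAle eq_sym nij ji (leq_ltn_trans (leq_subr _ _)).
Qed.

(** All [n] frequencies are used, so that [k] and [n - k] each contribute half of
    a real mode; this avoids treating the frequencies [0] and [n / 2] apart. *)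
Lemma Fourier_inversion (R : realType) n (x : 'Z_n -> R) (j : 'Z_n) : (1 < n)%N ->
  x j = \sum_(0 <= k < n) wave R n k (fcos R n x k) (fsin R n x k) j.
Proof.
move=> n1; have lt_n (i : 'Z_n) : (i < n)%N by rewrite -[ltnRHS](Zp_cast n1).
transitivity (avg n (fun i : 'Z_n => \sum_(0 <= k < n)
    x i * cos (turn R n * (k * i)%:R - turn R n * (k * j)%:R))); last first.
  rewrite avg_sum; apply: eq_bigr => k _; rewrite /wave /fcos /fsin.
  rewrite ![avg _ _ * _]mulrC -!avgZ -avgD; apply: eq_avg => i.
  by rewrite cosB; ring.
rewrite /avg (bigD1 j)//= [X in _ + X]big1 => [|i /negPf ij]; last first.
  by rewrite -mulr_sumr sum_cos_diff// -val_eqE in ij *; rewrite ij mulr0.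
rewrite addr0 -mulr_sumr sum_cos_diff// eqxx mulrCA mulVf ?mulr1//.
by rewrite pnatr_eq0; case: n n1 {lt_n} x j.
Qed.

Lemma Parseval (R : realType) n (x : 'Z_n -> R) : (1 < n)%N ->
  avg n (fun j => x j ^+ 2) = \sum_(0 <= k < n) power R n x k.
Proof.
move=> n1; transitivity (avg n (fun j : 'Z_n => \sum_(0 <= k < n)
    x j * wave R n k (fcos R n x k) (fsin R n x k) j)).
  by apply: eq_avg => j; rewrite expr2 -mulr_sumr -Fourier_inversion.
by rewrite avg_sum; apply: eq_bigr => k _; rewrite avg_mul_wave /power; ring.
Qed.

Lemma fcos_shift (R : realType) n (x : 'Z_n -> R) k : (1 < n)%N ->
  fcos R n (fun j => x (j + 1)) k
  = cos (turn R n * k%:R) * fcos R n x k + sin (turn R n * k%:R) * fsin R n x k.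
Proof.
move=> n1; rewrite /fcos /fsin -!avgZ -avgD -[RHS]avg_shift; apply: eq_avg => j.
rewrite cos_turn_succ// sin_turn_succ//.
have {1}-> : turn R n * (k * j)%:R
    = turn R n * (k * j)%:R + turn R n * k%:R - turn R n * k%:R by ring.
by rewrite cosB; ring.
Qed.

Lemma fsin_shift (R : realType) n (x : 'Z_n -> R) k : (1 < n)%N ->
  fsin R n (fun j => x (j + 1)) k
  = cos (turn R n * k%:R) * fsin R n x k - sin (turn R n * k%:R) * fcos R n x k.
Proof.
move=> n1; rewrite /fcos /fsin -mulNr -!avgZ -avgD -[RHS]avg_shift; apply: eq_avg => j.
rewrite cos_turn_succ// sin_turn_succ//.
have {1}-> : turn R n * (k * j)%:R
    = turn R n * (k * j)%:R + turn R n * k%:R - turn R n * k%:R by ring.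
by rewrite sinB; ring.
Qed.

(** The shift multiplies the [k]-th coefficient by [e^(i k phi)], where
    [phi = 2 pi / n], and [|1 - e^(i k phi)|^2 = 2 (1 - cos (k phi))]. *)
Lemma power_diff (R : realType) n (x : 'Z_n -> R) k : (1 < n)%N ->
  power R n (fun j => x j - x (j + 1)) k
  = 2 * (1 - cos (turn R n * k%:R)) * power R n x k.
Proof.
move=> n1.
have Ec : fcos R n (fun j => x j - x (j + 1)) k
    = fcos R n x k - fcos R n (fun j => x (j + 1)) k.
  by rewrite /fcos -[- avg _ _]mulN1r -avgZ -avgD; apply: eq_avg => j; ring.
have Es : fsin R n (fun j => x j - x (j + 1)) k
    = fsin R n x k - fsin R n (fun j => x (j + 1)) k.
  by rewrite /fsin -[- avg _ _]mulN1r -avgZ -avgD; apply: eq_avg => j; ring.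
rewrite /power Ec Es fcos_shift// fsin_shift//.
have := sin2cos2 (turn R n * k%:R).
move: (cos _) (sin _) (fcos _ _ _ _) (fsin _ _ _ _) => c s A B s2.
transitivity (((1 - c) ^+ 2 + s ^+ 2) * (A ^+ 2 + B ^+ 2)); first by ring.
by rewrite s2; ring.
Qed.

Lemma dirichletE (R : realType) n (x : 'Z_n -> R) : (1 < n)%N ->
  dirichlet n x = \sum_(0 <= k < n)
    2 * (1 - cos (turn R n * k%:R)) * power R n x k.
Proof.
by move=> n1; rewrite /dirichlet Parseval//; apply: eq_bigr => k _; rewrite power_diff.
Qed.

(** * Products of waves *)

Lemma avg_wave (R : realType) n k (A B : R) : (0 < k < n)%N ->
  avg n (fun j => wave R n k A B j) = 0.
Proof.
move=> kn; have n1 : (1 < n)%N by case/andP: kn; case: n k => [|[|n]] [|k].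
rewrite avgE// /wave big_split/= -!mulr_sumr.
have := sum_cos_turn R n k 0 kn; have := sum_sin_turn R n k 0 kn.
under eq_bigr do rewrite addr0; move=> ->.
under eq_bigr do rewrite addr0; move=> ->.
by rewrite !mulr0 addr0 mulr0.
Qed.

Lemma wave0 (R : realType) n (A B : R) j : wave R n 0 A B j = A.
Proof. by rewrite /wave mul0n mulr0 cos0 sin0 mulr1 mulr0 addr0. Qed.

(** The second factor carries the larger frequency because frequencies are
    natural numbers and [l - k] has to be the true difference. *)
Lemma waveM (R : realType) n k l (A B A' B' : R) j : (k <= l)%N ->
  wave R n k A B j * wave R n l A' B' j
  = wave R n (l - k) ((A * A' + B * B') / 2) ((A * B' - B * A') / 2) j
    + wave R n (l + k) ((A * A' - B * B') / 2) ((A * B' + B * A') / 2) j.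
Proof.
move=> kl; rewrite /wave mulnBl mulnDl natrD natrB ?leq_mul2r ?kl ?orbT//.
by rewrite !(mulrBr (turn R n)) !(mulrDr (turn R n)) !cosB !cosD !sinB !sinD; field.
Qed.

Lemma wave_sqr (R : realType) n k (A B : R) j :
  wave R n k A B j ^+ 2
  = (A ^+ 2 + B ^+ 2) / 2 + wave R n (k + k) ((A ^+ 2 - B ^+ 2) / 2) (A * B) j.
Proof.
rewrite expr2 waveM// subnn wave0 -!expr2; congr (_ + wave _ _ _ _ _ _).
by field.
Qed.

Lemma wave_sqr_le (R : realType) n k (A B : R) j :
  wave R n k A B j ^+ 2 <= A ^+ 2 + B ^+ 2.
Proof.
rewrite /wave; move: (cos2Dsin2 (turn R n * (k * j)%:R)).
move: (cos _) (sin _) => c s cs; rewrite -subr_ge0.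
rewrite -[A ^+ 2 + _]mulr1 -cs (_ : _ - _ = (A * s - B * c) ^+ 2) ?sqr_ge0//.
by ring.
Qed.

(** The product has the frequencies [l - k] and [l + k]; the bound on [k + l]
    keeps the latter from being a multiple of [n]. *)
Lemma avg_waveM (R : realType) n k l (A B A' B' : R) :
  (0 < k <= l)%N -> (k + l < n)%N ->
  avg n (fun j => wave R n k A B j * wave R n l A' B' j)
  = (A * A' + B * B') / 2 *+ (k == l).
Proof.
move=> /andP[k0 kl] kln.
have n1 : (1 < n)%N by case: n k l k0 kl kln => [|[|n]] [|k] [|l].
rewrite (eq_avg _ _ _ _ (fun j => waveM R n k l A B A' B' j kl)) avgD.
rewrite [X in _ + X]avg_wave ?addr0; last by rewrite addnC kln addn_gt0 k0.
have [->|nkl] := eqVneq k l.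
  by under eq_avg do rewrite subnn wave0; rewrite avg_cst.
rewrite avg_wave// subn_gt0 ltn_neqAle nkl kl/=.
by rewrite (leq_ltn_trans _ kln)// (leq_trans (leq_subr _ _))// leq_addl.
Qed.

(** * An upper bound on the spectral gap *)

(** Test function: [cos (2 pi j / n)]. *)
Lemma spectral_gap_le (R : realType) n : (2 < n)%N ->
  spectral_gap R n <= 1 - cos (turn R n).
Proof.
move=> n2; have n1 := ltnW n2.
pose f (j : 'Z_n) := wave R n 1 1 0 j.
have avgf : avg n f = 0 by exact: avg_wave.
have varf : variance n f = 2^-1.
  rewrite /variance avgf expr0n subr0 /f.
  under eq_avg do rewrite expr2.
  by rewrite avg_waveM// eqxx mulr1n; field.
have dirf : dirichlet n f = 1 - cos (turn R n).
  rewrite /dirichlet (_ : (fun _ => _) = fun j : 'Z_n =>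
    wave R n 1 (1 - cos (turn R n)) (sin (turn R n)) j
    * wave R n 1 (1 - cos (turn R n)) (sin (turn R n)) j).
    rewrite avg_waveM// eqxx mulr1n -!expr2 sin2cos2; by field.
  apply/funext => j; rewrite /f {1 2}/wave cos_turn_succ// mulr1 cosD /wave; ring.
apply: ge_inf.
  exists 0 => _ [g /= vg <-]; rewrite mulr_ge0 ?invr_ge0 ?(ltW vg)//.
  by rewrite mulr_ge0 ?invr_ge0// /dirichlet; apply: avg_ge0 => j; rewrite sqr_ge0.
exists f; first by rewrite /= varf invr_gt0.
by rewrite dirf varf; field.
Qed.

(** * Spacing of the eigenvalues *)

Lemma sin_half_turn_ge0 (R : realType) n m : (0 < n)%N -> (m <= n)%N ->
  0 <= sin (turn R n * m%:R / 2).
Proof.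
move=> n0; case: m => [|m]; first by rewrite mulr0 mul0r sin0.
rewrite leq_eqVlt => /predU1P[->|mn]; last by rewrite ltW ?sin_half_turn_gt0.
rewrite (_ : _ / 2 = pi) ?sinpi// /turn -[pi *+ 2]mulr_natl; field.
by rewrite pnatr_eq0 -lt0n.
Qed.

Lemma cos_turn_lt1 (R : realType) n : (1 < n)%N -> cos (turn R n) < 1.
Proof.
move=> n1; have := sin_half_turn_gt0 R n 1; rewrite n1 mulr1 => /(_ isT) s0.
have -> : turn R n = (turn R n / 2) *+ 2 by rewrite -mulr_natr; field.
by rewrite cos_mulr2n cos2sin2; nra.
Qed.

Lemma cosB_half (R : realType) (a b : R) :
  cos a - cos b = 2 * sin ((b + a) / 2) * sin ((b - a) / 2).
Proof.
have -> : cos a = cos ((b + a) / 2 - (b - a) / 2) by congr cos; field.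
have -> : cos b = cos ((b + a) / 2 + (b - a) / 2) by congr cos; field.
by rewrite cosB cosD; ring.
Qed.

Lemma cosB_turn (R : realType) n k l : (k <= l)%N ->
  cos (turn R n * k%:R) - cos (turn R n * l%:R)
  = 2 * sin (turn R n * (l + k)%:R / 2) * sin (turn R n * (l - k)%:R / 2).
Proof.
by move=> kl; rewrite cosB_half natrD natrB//; congr (2 * sin _ * sin _); ring.
Qed.

(** The cosine decreases up to half a turn and is symmetric about it, whence the
    condition on [k + l]. *)
Lemma cos_turn_anti (R : realType) n k l : (k <= l)%N -> (k + l <= n)%N -> (0 < n)%N ->
  cos (turn R n * l%:R) <= cos (turn R n * k%:R).
Proof.
move=> kl kln n0; rewrite -subr_ge0 cosB_turn// !mulr_ge0// sin_half_turn_ge0//.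
  by rewrite addnC.
by rewrite (leq_trans (leq_subr _ _))// (leq_trans _ kln)// leq_addl.
Qed.

Lemma cos_turn_lt (R : realType) n k l : (k < l)%N -> (k + l < n)%N ->
  cos (turn R n * l%:R) < cos (turn R n * k%:R).
Proof.
move=> kl kln; rewrite -subr_gt0 cosB_turn 1?ltnW// !mulr_gt0// sin_half_turn_gt0//.
  by rewrite addnC kln andbT addn_gt0 orbC (leq_ltn_trans _ kl).
rewrite subn_gt0 kl (leq_ltn_trans (leq_subr _ _))// (leq_ltn_trans _ kln)//.
by rewrite leq_addl.
Qed.

(** The frequencies [0], [1] and [n - 1] are set apart from the high ones. *)
Lemma sum_split3 (R : realType) n (F : nat -> R) : (2 < n)%N ->
  \sum_(0 <= k < n) F k
  = F 0%N + F 1%N + \sum_(2 <= k < n.-1) F k + F n.-1.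
Proof.
case: n => [|[|[|n]]]// _.
by rewrite big_nat_recr//= big_ltn// big_ltn// !addrA.
Qed.

(** Cauchy-Schwarz for the vectors [d^(-1/2)] and [d^(1/2) z], proved by induction
    so as not to use square roots. *)
Lemma weighted_Cauchy_Schwarz (R : realType) (I : eqType) (r : seq I) (d z : I -> R) :
  (forall i, i \in r -> 0 < d i) ->
  (\sum_(i <- r) z i) ^+ 2
  <= (\sum_(i <- r) (d i)^-1) * \sum_(i <- r) d i * z i ^+ 2.
Proof.
elim: r => [|i r IH] d0; first by rewrite !big_nil mulr0 expr0n.
have {}IH : (\sum_(i <- r) z i) ^+ 2
  <= (\sum_(i <- r) (d i)^-1) * \sum_(i <- r) d i * z i ^+ 2.
  by apply: IH => j jr; rewrite d0// inE jr orbT.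
have di : 0 < d i by rewrite d0// mem_head.
rewrite !big_cons.
have S0 : 0 <= \sum_(i <- r) (d i)^-1.
  by rewrite big_seq sumr_ge0// => j jr; rewrite invr_ge0 ltW// d0// inE jr orbT.
have T0 : 0 <= \sum_(i <- r) d i * z i ^+ 2.
  rewrite big_seq sumr_ge0// => j jr.
  by rewrite mulr_ge0 ?sqr_ge0// ltW// d0// inE jr orbT.
move: (\sum_(i <- r) z i) (\sum_(i <- r) (d i)^-1) (\sum_(i <- r) d i * _) IH S0 T0.
move=> s S T sST S0 T0; move: (z i) (d i) di => y e e0.
have e0' : e != 0 by rewrite gt_eqF.
have -> : (e^-1 + S) * (e * y ^+ 2 + T) = y ^+ 2 + (S * e * y ^+ 2 + T / e) + S * T.
  by field.
suff : 2 * y * s <= S * e * y ^+ 2 + T / e by nra.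
have [S_0|S_neq0] := eqVneq S 0.
  have -> : s = 0 by apply/eqP; rewrite -sqrf_eq0 eq_le sqr_ge0 andbT; nra.
  by rewrite S_0 mulr0 !mul0r add0r divr_ge0// ltW.
have Se0 : 0 < S * e by rewrite mulr_gt0// lt_def S_neq0.
rewrite -(ler_pM2l Se0) -subr_ge0.
have -> : S * e * (S * e * y ^+ 2 + T / e) - S * e * (2 * y * s)
    = (S * e * y - s) ^+ 2 + (S * T - s ^+ 2) by field.
by rewrite addr_ge0 ?sqr_ge0 ?subr_ge0.
Qed.

(** With [c = cos (2 pi / n)], the right side is at least
    [c - cos (4 pi / n) = (1 - c) (1 + 2 c)], so [c >= 3 / 10] suffices.  That
    bound follows from [cos (3 phi) <= cos (2 phi)], valid as [2 + 3 <= n],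
    which reads [4 c^2 + 2 c - 1 >= 0]. *)
Lemma gap_second (R : realType) n k : (4 < n)%N -> (2 <= k < n.-1)%N ->
  8 / 5 * (1 - cos (turn R n)) <= cos (turn R n) - cos (turn R n * k%:R).
Proof.
move=> n4 /andP[k2 kn]; have n1 : (1 < n)%N by rewrite (leq_trans _ n4).
have c1 := cos_turn_lt1 R n n1.
have kn2 : (2 + k <= n)%N by rewrite addnC addn2 -ltn_predRL.
have := cos_turn_anti R n 2 k k2 kn2 (ltnW n1).
have := cos_turn_anti R n 2 3 isT n4 (ltnW n1).
have := cos_turn_anti R n 1 3 isT (ltnW n4) (ltnW n1).
rewrite mulr1 (_ : _ * 3 = turn R n *+ 2 + turn R n); last by ring.
rewrite [_ * 2]mulr_natr cosD sin_mulr2n cos_mulr2n.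
set c := cos (turn R n) in c1 *; set s := sin (turn R n).
have s2 : s ^+ 2 = 1 - c ^+ 2 by rewrite sin2cos2.
have -> : (c ^+ 2 *+ 2 - 1) * c - c * s *+ 2 * s
   = (c ^+ 2 *+ 2 - 1) * c - c * s ^+ 2 *+ 2 by ring.
rewrite s2 => c3 c32 c2k.
(* The inequality c3, that is c (c^2 - 1) <= 0, gives c >= 0 only when c > -1. *)
have cN1 : - 1 < c.
  have := cos_turn_lt R n 1 2 isT; rewrite mulr1 [_ * 2]mulr_natr cos_mulr2n.
  rewrite -/c (leq_trans _ n4)// => /(_ isT).
  by have := cos_geN1 (turn R n); rewrite -/c; nra.
have c0 : 0 <= c by nra.
have : 0 <= 4 * c ^+ 2 + 2 * c - 1 by nra.
move=> c5; have : 3 / 10 <= c by nra.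
by nra.
Qed.

(** With [h = pi / n], [cos (2 h) - cos (2 k h)] is
    [2 sin ((k + 1) h) sin ((k - 1) h)], whose inverse is
    [(cot ((k - 1) h) - cot ((k + 1) h)) / (2 sin (2 h))].  The sum telescopes
    and the product equals [2 - 1 / (2 cos^2 h)]. *)
Lemma sum_inv_gap (R : realType) n : (3 < n)%N ->
  (1 - cos (turn R n))
    * \sum_(2 <= k < n.-1) (cos (turn R n) - cos (turn R n * k%:R))^-1 <= 2.
Proof.
move=> n3; set h := turn R n / 2.
have n0 : (0 < n)%N by rewrite (leq_trans _ n3).
pose ct m := cos (h * m%:R) / sin (h * m%:R).
have hE m : turn R n * m%:R / 2 = h * m%:R by rewrite /h mulrAC.
have s_gt0 m : (0 < m < n)%N -> 0 < sin (h * m%:R).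
  by rewrite -hE; exact: sin_half_turn_gt0.
have s1 : 0 < sin h by have := s_gt0 1%N; rewrite mulr1; apply; rewrite (leq_trans _ n3).
have s2 : 0 < sin (h *+ 2) by rewrite -mulr_natr s_gt0// (leq_trans _ n3).
have ctN m : (m < n)%N -> ct (n - m)%N = - ct m.
  move=> mn; rewrite /ct natrB 1?ltnW// mulrBr.
  have -> : h * n%:R = pi.
    by rewrite /h /turn -[pi *+ 2]mulr_natl; field; rewrite pnatr_eq0 -lt0n.
  by rewrite -[pi - _]addrC cosDpi sinDpi cosN sinN; rewrite opprK mulNr.
have term k : (2 <= k < n.-1)%N ->
    (cos (turn R n) - cos (turn R n * k%:R))^-1
    = ((ct k.-1 - ct k) + (ct k - ct k.+1)) / (2 * sin (h *+ 2)).
  move=> /andP[k2 kn]; case: k k2 kn => // k k2 kn.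
  have := cosB_turn R n 1 k.+1 isT; rewrite mulr1 => ->.
  rewrite !hE addn1 subn1 /= /ct.
  have a0 : 0 < sin (h * k%:R).
    by rewrite s_gt0//; apply/andP; split=> //; lia.
  have p0 : 0 < sin (h * k.+2%:R) by rewrite s_gt0//; lia.
  have D : sin (h *+ 2) = sin (h * k.+2%:R) * cos (h * k%:R)
                         - cos (h * k.+2%:R) * sin (h * k%:R).
    by rewrite -sinB; congr sin; rewrite -(addn2 k) natrD; ring.
  have := s2; rewrite D.
  move: (sin (h * k%:R)) (sin (h * k.+2%:R)) a0 p0 => a p a0 p0 d0.
  by field; rewrite !gt_eqF// s_gt0//; lia.
rewrite (eq_big_nat _ _ term) -mulr_suml big_split/=.
rewrite (telescope_sumr_eq (fun k => - ct k.-1)); [|lia|by move=> k _ /=; ring].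
rewrite (telescope_sumr_eq (fun k => - ct k)); [|lia|by move=> k _ /=; ring].
have -> : ct n.-1.-1 = - ct 2%N by rewrite -ctN ?(ltn_trans _ n3)//; congr ct; lia.
have -> : ct n.-1 = - ct 1%N by rewrite -ctN ?(ltn_trans _ n3)//; congr ct; lia.
rewrite /ct /= mulr1 [h * 2]mulr_natr.
have -> : turn R n = h *+ 2 by rewrite -mulr_natr /h; field.
rewrite sin_mulr2n cos_mulr2n in s2 *.
have c0 : 0 < cos h by rewrite pmulrn_lgt0// pmulr_lgt0 in s2.
move: (sin2cos2 h) s1 c0 {s2}; move: (sin h) (cos h) => s c sc s0 c0.
have -> : 1 - (c ^+ 2 *+ 2 - 1) = s ^+ 2 *+ 2 by rewrite sc; ring.
rewrite (_ : _ * _ = 2 - (c ^- 2) / 2); last by field; rewrite !gt_eqF.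
by rewrite gerBl divr_ge0// invr_ge0 sqr_ge0.
Qed.

(** * Low and high frequencies *)

Lemma fcos0 (R : realType) n (x : 'Z_n -> R) : fcos R n x 0 = avg n x.
Proof. by apply: eq_avg => j; rewrite mul0n mulr0 cos0 mulr1. Qed.

Lemma fsin0 (R : realType) n (x : 'Z_n -> R) : fsin R n x 0 = 0.
Proof.
transitivity (avg n (fun j => 0 * x j)); last by rewrite avgZ mul0r.
by apply: eq_avg => j; rewrite mul0n mulr0 sin0 mulr0 mul0r.
Qed.

(** Frequency [n - 1] is frequency [-1], up to whole turns. *)
Lemma turn_pred (R : realType) n j : (1 < n)%N ->
  turn R n * (n.-1 * j)%:R = - (turn R n * (1 * j)%:R) + turn R n * (j * n)%:R.
Proof.
move=> n1; rewrite -mulrN -mulrDr; congr (_ * _).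
have -> : (j * n = j + n.-1 * j)%N by case: n n1 => // n _ /=; lia.
by rewrite natrD mul1n; ring.
Qed.

Lemma fcos_pred (R : realType) n (x : 'Z_n -> R) : (1 < n)%N ->
  fcos R n x n.-1 = fcos R n x 1.
Proof.
by move=> n1; apply: eq_avg => j; rewrite turn_pred// cos_turnD// cosN.
Qed.

Lemma fsin_pred (R : realType) n (x : 'Z_n -> R) : (1 < n)%N ->
  fsin R n x n.-1 = - fsin R n x 1.
Proof.
move=> n1; rewrite -mulN1r -avgZ; apply: eq_avg => j.
by rewrite turn_pred// sin_turnD// sinN; ring.
Qed.

Lemma power_pred (R : realType) n (x : 'Z_n -> R) : (1 < n)%N ->
  power R n x n.-1 = power R n x 1.
Proof. by move=> n1; rewrite /power fcos_pred// fsin_pred// sqrrN. Qed.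

Lemma cos_pred (R : realType) n : (1 < n)%N ->
  cos (turn R n * n.-1%:R) = cos (turn R n).
Proof.
move=> n1; have := turn_pred R n 1 n1; rewrite !muln1 mulr1 => ->.
by rewrite cos_turnD// cosN.
Qed.

Lemma power0 (R : realType) n (x : 'Z_n -> R) : power R n x 0 = avg n x ^+ 2.
Proof. by rewrite /power fcos0 fsin0 expr0n addr0. Qed.

Lemma power_ge0 (R : realType) n (x : 'Z_n -> R) k : 0 <= power R n x k.
Proof. by rewrite addr_ge0 ?sqr_ge0. Qed.

(** The factors [2] collect the equal contributions of the frequencies [1] and
    [n - 1]. *)
Definition low (R : realType) n (x : 'Z_n -> R) (j : 'Z_n) : R :=
  wave R n 1 (2 * fcos R n x 1) (2 * fsin R n x 1) j.

Definition high (R : realType) n (x : 'Z_n -> R) (j : 'Z_n) : R :=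
  x j - avg n x - low R n x j.

Lemma highE (R : realType) n (x : 'Z_n -> R) (j : 'Z_n) : (2 < n)%N ->
  high R n x j
  = \sum_(2 <= k < n.-1) wave R n k (fcos R n x k) (fsin R n x k) j.
Proof.
move=> n2; have n1 := ltnW n2; rewrite /high (Fourier_inversion R n x j n1).
rewrite sum_split3// wave0 fcos0 fcos_pred// fsin_pred//.
rewrite /low {3}/wave turn_pred// cos_turnD// sin_turnD// cosN sinN /wave.
by ring.
Qed.

Lemma high_energy_gap (R : realType) n (x : 'Z_n -> R) :
  (4 < n)%N ->
  8 / 5 * (1 - cos (turn R n)) * \sum_(2 <= k < n.-1) power R n x k
  <= \sum_(2 <= k < n.-1) (cos (turn R n) - cos (turn R n * k%:R)) * power R n x k.
Proof.
move=> n4; rewrite mulr_sumr !big_nat; apply: ler_sum => k kn.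
by rewrite ler_wpM2r ?power_ge0 ?gap_second.
Qed.

(** Cauchy-Schwarz over the high frequencies, with the energy gaps as weights. *)
Lemma high_sup (R : realType) n (x : 'Z_n -> R) (j : 'Z_n) : (3 < n)%N ->
  (1 - cos (turn R n)) * high R n x j ^+ 2
  <= 2 * \sum_(2 <= k < n.-1) (cos (turn R n) - cos (turn R n * k%:R)) * power R n x k.
Proof.
move=> n3; have n1 : (1 < n)%N by rewrite (leq_trans _ n3).
have d0 k : (2 <= k < n.-1)%N -> 0 < cos (turn R n) - cos (turn R n * k%:R).
  move=> kn; rewrite subr_gt0 -[X in _ < cos X]mulr1.
  by rewrite (cos_turn_lt R n 1 k)//; lia.
rewrite highE ?(ltnW n3)//.
have CS := weighted_Cauchy_Schwarz R nat (index_iota 2 n.-1)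
  (fun k => cos (turn R n) - cos (turn R n * k%:R))
  (fun k => wave R n k (fcos R n x k) (fsin R n x k) j).
have mu0 : 0 <= 1 - cos (turn R n) by rewrite subr_ge0 cos_le1.
apply: le_trans (ler_wpM2l mu0 (CS _)) _ => [k|].
  by rewrite mem_index_iota; exact: d0.
rewrite mulrA; apply: ler_pM.
- by rewrite mulr_ge0// big_nat sumr_ge0// => k kn; rewrite invr_ge0 ltW ?d0.
- by rewrite big_nat sumr_ge0// => k kn; rewrite mulr_ge0 ?sqr_ge0// ltW ?d0.
- exact: sum_inv_gap.
rewrite !big_nat; apply: ler_sum => k kn.
by rewrite ler_wpM2l ?wave_sqr_le// ltW ?d0.
Qed.

Lemma avg_low (R : realType) n (x : 'Z_n -> R) : (1 < n)%N ->
  avg n (low R n x) = 0.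
Proof. by move=> n1; exact: (avg_wave R n 1). Qed.

Lemma avg_high (R : realType) n (x : 'Z_n -> R) : (1 < n)%N ->
  avg n (high R n x) = 0.
Proof.
move=> n1; transitivity (avg n x + - 1 * avg n (low R n x) + avg n (fun=> - avg n x)).
  by rewrite -!avgZ -!avgD; apply: eq_avg => j; rewrite /high /=; ring.
by rewrite avg_low// avg_cst//; ring.
Qed.

Lemma avg_low_sqr (R : realType) n (x : 'Z_n -> R) : (2 < n)%N ->
  avg n (fun j => low R n x j ^+ 2) = 2 * power R n x 1.
Proof.
move=> n2; rewrite (eq_avg _ _ _ _ (fun j => expr2 _)) avg_waveM// eqxx mulr1n.
by rewrite /power; field.
Qed.

Lemma avg_mul_low (R : realType) n (x : 'Z_n -> R) :
  avg n (fun j => x j * low R n x j) = 2 * power R n x 1.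
Proof. by rewrite avg_mul_wave /power; ring. Qed.

Lemma avg_high_sqr (R : realType) n (x : 'Z_n -> R) : (2 < n)%N ->
  avg n (fun j => high R n x j ^+ 2)
  = avg n (fun j => x j ^+ 2) - avg n x ^+ 2 - 2 * power R n x 1.
Proof.
move=> n2; have n1 := ltnW n2.
pose a := avg n x; have aE : avg n x = a by []; clearbody a.
transitivity (avg n (fun j => x j ^+ 2) + avg n (fun=> a ^+ 2)
   + avg n (fun j => low R n x j ^+ 2) + (- 2 * a) * avg n x
   + (- 2) * avg n (fun j => x j * low R n x j) + (2 * a) * avg n (low R n x)).
  by rewrite -!avgZ -!avgD; apply: eq_avg => j; rewrite /high aE /=; ring.
by rewrite avg_cst// avg_low_sqr// avg_mul_low avg_low// aE; ring.
Qed.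

Lemma sum_high_power (R : realType) n (x : 'Z_n -> R) : (2 < n)%N ->
  \sum_(2 <= k < n.-1) power R n x k = avg n (fun j => high R n x j ^+ 2).
Proof.
move=> n2; have n1 := ltnW n2; rewrite avg_high_sqr// Parseval// sum_split3//.
by rewrite power0 power_pred//; ring.
Qed.

Lemma dirichlet_split (R : realType) n (x : 'Z_n -> R) : (2 < n)%N ->
  dirichlet n x = 2 * (1 - cos (turn R n))
      * (avg n (fun j => low R n x j ^+ 2) + avg n (fun j => high R n x j ^+ 2))
    + 2 * \sum_(2 <= k < n.-1)
        (cos (turn R n) - cos (turn R n * k%:R)) * power R n x k.
Proof.
move=> n2; have n1 := ltnW n2; rewrite dirichletE// sum_split3//.
rewrite -sum_high_power// avg_low_sqr// power_pred// cos_pred//.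
rewrite mulr0 cos0 mulr1 subrr mulr0 mul0r add0r.
rewrite (eq_bigr (fun k => 2 * (1 - cos (turn R n)) * power R n x k
  + 2 * ((cos (turn R n) - cos (turn R n * k%:R)) * power R n x k))); last first.
  by move=> k _; ring.
rewrite big_split/= -!mulr_sumr; ring.
Qed.

(** * The cubic inequality on cycles of length at least five *)

(** Expansion of the cube around [a], arranged so that every term but the first
    five vanishes when [f] and [w] have mean zero and [f^2 - t] is orthogonal
    to [f]. *)
Lemma avg_cube_expand (R : realType) n (a t : R) (f w : 'Z_n -> R) : (1 < n)%N ->
  avg n (fun j => (a + f j + w j) ^+ 3)
  = 3 * a * avg n (fun j => (a + f j + w j) ^+ 2) - 2 * a ^+ 3
    + 3 * avg n (fun j => (f j ^+ 2 - t) * w j)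
    + 3 * avg n (fun j => f j * w j ^+ 2) + avg n (fun j => w j ^+ 3)
    + (3 * t - 3 * a ^+ 2) * avg n w
    + avg n (fun j => f j * (f j ^+ 2 - t)) + (t - 3 * a ^+ 2) * avg n f.
Proof.
move=> n1; rewrite -[X in _ - X](avg_cst R n _ n1) -[- avg _ _]mulN1r.
by rewrite -!avgZ -!avgD; apply: eq_avg => j /=; ring.
Qed.

(** The three terms that involve [w = high x] are bounded separately.  Each use of the inequality of
    arithmetic and geometric means takes fixed constants, chosen so that
    [energy_beats_cubic] holds for the resulting bound. *)
Lemma avg_cube_le (R : realType) n (x : 'Z_n -> R) (e t q : R) : (4 < n)%N ->
  (forall j, high R n x j ^+ 2 <= 2 * e) ->
  avg n (fun j => low R n x j ^+ 2) = t ->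
  avg n (fun j => high R n x j ^+ 2) = q ->
  avg n (fun j => x j ^+ 3)
  <= avg n x ^+ 3 + 3 * avg n x * (t + q) + 3 * (t ^+ 2 / 4 + q / 2)
     + 3 * ((5 / 6 * t + 3 / 5) * q) + (e + 1 / 2) * q.
Proof.
move=> n4 he tD qD; have n1 : (1 < n)%N by rewrite (leq_trans _ n4).
have n2 : (2 < n)%N by rewrite (leq_trans _ n4).
set a := avg n x; pose f := low R n x; pose w := high R n x.
pose A := 2 * fcos R n x 1; pose B := 2 * fsin R n x 1.
pose g (j : 'Z_n) := wave R n (1 + 1) ((A ^+ 2 - B ^+ 2) / 2) (A * B) j.
have tE : t = (A ^+ 2 + B ^+ 2) / 2.
  by rewrite -tD avg_low_sqr// /A /B /power; field.
have f2 j : f j ^+ 2 = t + g j by rewrite tE; exact: wave_sqr.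
have f2le j : f j ^+ 2 <= 2 * t.
  by apply: le_trans (wave_sqr_le _ _ _ _ _ _) _; rewrite tE -/A -/B; lra.
have fg : avg n (fun j => f j * g j) = 0.
  by rewrite avg_waveM// (leq_trans _ n4).
have g2 : avg n (fun j => g j ^+ 2) = t ^+ 2 / 2.
  rewrite (eq_avg _ _ _ _ (fun j => expr2 _)) avg_waveM// eqxx mulr1n tE; by field.
have xE j : x j = a + f j + w j by rewrite /w /f /high -/a; ring.
have gE j : f j ^+ 2 - t = g j by rewrite f2 addrC addKr.
have -> : avg n (fun j => x j ^+ 3) = a ^+ 3 + 3 * a * (t + q)
    + 3 * avg n (fun j => g j * w j) + 3 * avg n (fun j => f j * w j ^+ 2)
    + avg n (fun j => w j ^+ 3).
  have <- : avg n (fun j => (a + f j + w j) ^+ 3) = avg n (fun j => x j ^+ 3).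
    by apply: eq_avg => j; rewrite -xE.
  rewrite (avg_cube_expand R n a t f w n1).
  have -> : avg n (fun j => (a + f j + w j) ^+ 2) = avg n (fun j => x j ^+ 2).
    by apply: eq_avg => j; rewrite -xE.
  have -> : avg n (fun j => (f j ^+ 2 - t) * w j) = avg n (fun j => g j * w j).
    by apply: eq_avg => j; rewrite gE.
  have -> : avg n (fun j => f j * (f j ^+ 2 - t)) = avg n (fun j => f j * g j).
    by apply: eq_avg => j; rewrite gE.
  rewrite fg avg_high// avg_low//.
  have := avg_high_sqr R n x n2; rewrite -avg_low_sqr// tD qD -/a => ->; ring.
have gw : avg n (fun j => g j * w j) <= t ^+ 2 / 4 + q / 2.
  have -> : t ^+ 2 / 4 + q / 2 = avg n (fun j => 2^-1 * g j ^+ 2 + 2^-1 * w j ^+ 2).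
    by rewrite avgD !avgZ g2 qD; field.
  apply: le_avg => j; have := sqr_ge0 (g j - w j); nra.
(* Tangent line of the square at f = 6/5: f <= 5/12 f^2 + 3/5. *)
have fw : avg n (fun j => f j * w j ^+ 2) <= (5 / 6 * t + 3 / 5) * q.
  rewrite -qD -avgZ; apply: le_avg => j; rewrite ler_wpM2r ?sqr_ge0//.
  have := f2le j; have := sqr_ge0 (f j - 6 / 5); nra.
(* Tangent line at w = 1: w <= w^2 / 2 + 1 / 2 <= e + 1 / 2. *)
have w3 : avg n (fun j => w j ^+ 3) <= (e + 1 / 2) * q.
  rewrite -qD -avgZ; apply: le_avg => j; rewrite exprS ler_wpM2r ?sqr_ge0//.
  have := he j; have := sqr_ge0 (w j - 1); rewrite -/(w j); nra.
lra.
Qed.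

(** Eliminating [a^3] leaves [(1 - a)^2 (1 + 2 a) >= 3/4 (t + q)^2] to pay for
    the [t^2] term, and [e >= 8/5 q] to pay for the rest: what remains is at
    least [q (1 - t - 17/20 q)], which is nonnegative since [t + q <= 1]. *)
Lemma energy_beats_cubic (R : realFieldType) (a t q e : R) :
  0 <= a -> 0 <= t -> 0 <= q -> a ^+ 2 + t + q = 1 -> 8 / 5 * q <= e ->
  a ^+ 3 + 3 * a * (t + q) + 3 * (t ^+ 2 / 4 + q / 2)
     + 3 * ((5 / 6 * t + 3 / 5) * q) + (e + 1 / 2) * q - 3 * a + 2
  <= 3 * (t + q + e).
Proof.
move=> a0 t0 q0 atq qe.
have a1 : a <= 1 by nra.
have -> : a ^+ 3 + 3 * a * (t + q) = 3 * a - 2 * a ^+ 3.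
  by rewrite (_ : t + q = 1 - a ^+ 2); [ring|lra].
have g : 3 / 4 * (1 - a ^+ 2) ^+ 2 <= (1 - a) ^+ 2 * (1 + 2 * a).
  rewrite -subr_ge0.
  have -> : (1 - a) ^+ 2 * (1 + 2 * a) - 3 / 4 * (1 - a ^+ 2) ^+ 2
      = (1 - a) ^+ 2 * ((1 - a) * (1 + 3 * a)) / 4 by field.
  by rewrite divr_ge0// mulr_ge0 ?sqr_ge0// mulr_ge0; lra.
have tq : t + q = 1 - a ^+ 2 by lra.
have eq : (3 - q) * (8 / 5 * q) <= (3 - q) * e.
  by rewrite ler_wpM2l//; nra.
(* What is left once the bounds g and eq have been subtracted. *)
have rest : 0 <= q * (1 - t - 17 / 20 * q) by rewrite mulr_ge0//; nra.
rewrite -tq in g.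
have gE : (1 - a) ^+ 2 * (1 + 2 * a) = 3 * (t + q) - 2 + 2 * a ^+ 3.
  by rewrite tq; ring.
rewrite gE in g; nra.
Qed.

Lemma cubic_le_dirichlet (R : realType) n (x : 'Z_n -> R) : (4 < n)%N ->
  avg n (fun j => x j ^+ 2) = 1 -> 0 <= avg n x ->
  2 * (1 - cos (turn R n)) / 3 * (avg n (fun j => x j ^+ 3) - 3 * avg n x + 2)
  <= dirichlet n x.
Proof.
move=> n4 x2 a0; have n1 : (1 < n)%N by rewrite (leq_trans _ n4).
have n2 : (2 < n)%N by rewrite (leq_trans _ n4).
have mu0 : 0 < 1 - cos (turn R n) by rewrite subr_gt0 cos_turn_lt1.
rewrite dirichlet_split//.
set E := \sum_(2 <= k < n.-1) _ * _; set mu := 1 - cos (turn R n) in mu0 *.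
pose e := E / mu.
have EE : E = mu * e by rewrite /e mulrC divfK// gt_eqF.
have he j : high R n x j ^+ 2 <= 2 * e.
  by rewrite /e mulrA ler_pdivlMr// mulrC; exact: (high_sup R n x j (ltnW n4)).
set t := avg n (fun j => low _ _ _ _ ^+ 2); set q := avg n (fun j => high _ _ _ _ ^+ 2).
set a := avg n x in a0 *.
have x3 := avg_cube_le R n x e t q n4 he erefl erefl; rewrite -/a in x3.
have qe : 8 / 5 * q <= e.
  rewrite -(ler_pM2l mu0) -EE mulrCA mulrA.
  by have := high_energy_gap R n x n4; rewrite sum_high_power.
have qE : q = 1 - a ^+ 2 - t.
  by rewrite /q avg_high_sqr// x2 -/a /t avg_low_sqr.
have t0 : 0 <= t by apply: avg_ge0 => j; rewrite sqr_ge0.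
have q0 : 0 <= q by apply: avg_ge0 => j; rewrite sqr_ge0.
have atq : a ^+ 2 + t + q = 1 by rewrite qE; ring.
have := energy_beats_cubic R a t q e a0 t0 q0 atq qe => main.
rewrite EE (_ : _ + _ = 2 * mu / 3 * (3 * (t + q + e))); last by field.
apply: ler_wpM2l; first by rewrite divr_ge0// mulr_ge0// ltW.
by apply: le_trans main; rewrite lerD2r lerD2r.
Qed.

(** * The cubic inequality on the cycle of length four *)

(** In the coordinates [x = (a + s + p, a - s + r, a + s - p, a - s - r)] the only
    mixed term is [s (p^2 - r^2)], at most [2 |s| t] with [t = (p^2 + r^2) / 2].
    With [b = 1 - a] and [u = |s|] the claim follows from
      [u^3 + b^2 u - 2/3 b^3 + (u - b)^2 >= 0],
    and since [b <= 1] one may replace [(u - b)^2] by [b (u - b)^2], which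
    leaves the homogeneous cubic [u^3 + b u^2 - b^2 u + b^3 / 3]. *)
Lemma cubic_le_dirichlet4 (R : realType) (x : 'Z_4 -> R) :
  avg 4 (fun j => x j ^+ 2) = 1 -> 0 <= avg 4 x ->
  2 / 3 * (avg 4 (fun j => x j ^+ 3) - 3 * avg 4 x + 2) <= dirichlet 4 x.
Proof.
have sum4 (F : 'Z_4 -> R) : avg 4 F = (F 0 + F 1 + F 2 + F 3) / 4.
  rewrite /avg !big_ord_recl big_ord0 addr0 !addrA mulrC.
  by congr ((_ + F _ + F _ + F _) / _); apply: val_inj.
rewrite /dirichlet !sum4.
have -> : x (0 + 1) = x 1 by congr x; exact: val_inj.
have -> : x (1 + 1) = x 2 by congr x; exact: val_inj.
have -> : x (2 + 1) = x 3 by congr x; exact: val_inj.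
have -> : x (3 + 1) = x 0 by congr x; exact: val_inj.
move: (x 0) (x 1) (x 2) (x 3) => x0 x1 x2 x3 sq1.
set a := (_ / 4) => a0.
pose s := (x0 - x1 + x2 - x3) / 4.
pose p := (x0 - x2) / 2; pose r := (x1 - x3) / 2; pose t := (p ^+ 2 + r ^+ 2) / 2.
have E0 : x0 = a + s + p by rewrite /a /s /p; field.
have E1 : x1 = a - s + r by rewrite /a /s /r; field.
have E2 : x2 = a + s - p by rewrite /a /s /p; field.
have E3 : x3 = a - s - r by rewrite /a /s /r; field.
clearbody a s p r; subst x0 x1 x2 x3.
have tE : t = 1 - a ^+ 2 - s ^+ 2 by rewrite -sq1 /t; field.
have t0 : 0 <= t by rewrite divr_ge0// addr_ge0 ?sqr_ge0.
have a1 : a <= 1 by have := sqr_ge0 s; nra.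
have sumE : 1 - a ^+ 2 = t + s ^+ 2 by rewrite tE; ring.
set cubes := (X in X - 3 * a); set energy := (X in _ <= X).
have cubesE : cubes = a ^+ 3 + 3 * a * (1 - a ^+ 2) + 3 / 2 * s * (p ^+ 2 - r ^+ 2).
  by rewrite sumE /cubes /t; field.
have energyE : energy = 2 * (1 - a ^+ 2) + 2 * s ^+ 2.
  by rewrite sumE /energy /t; field.
rewrite cubesE energyE.
pose b := 1 - a.
have quad : `|s| * (2 * t) >= s * (p ^+ 2 - r ^+ 2).
  apply: le_trans (ler_norm _) _; rewrite normrM ler_wpM2l//.
  rewrite ler_norml /t; have := sqr_ge0 p; have := sqr_ge0 r; lra.
have u0 : 0 <= `|s| by []; have u2 : `|s| ^+ 2 = s ^+ 2 by rewrite real_normK ?num_real.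
move: u0 u2 quad; move: `|s| => u u0 u2 quad.
have b0 : 0 <= b by rewrite subr_ge0.
(* This is the cubic u^3 + b u^2 - b^2 u + b^3 / 3, with the square completed. *)
have cert : 0 <= u ^+ 3 + b * (u - b / 2) ^+ 2 + b ^+ 3 / 12.
  apply: addr_ge0; last by rewrite divr_ge0// exprn_ge0.
  by apply: addr_ge0; [rewrite exprn_ge0|rewrite mulr_ge0 ?sqr_ge0].
have cert2 : 0 <= (1 - b) * (u - b) ^+ 2.
  by rewrite mulr_ge0 ?sqr_ge0// /b subKr.
have main : u * t <= u ^+ 2 + b ^+ 2 * (3 - 2 * b) / 3.
  rewrite tE -u2 -subr_ge0; move: (addr_ge0 cert cert2); congr (0 <= _).
  by rewrite /b; field.
rewrite tE -u2 in quad main; rewrite -u2; move: quad main; rewrite /b; lra.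
Qed.

(** * The inequality with the spectral gap *)

Theorem theorem2 (R : realType) (n : nat) (hn : (4 <= n)%N)
    (x : 'Z_n -> R) (hx0 : forall j : 'Z_n, 0 <= x j)
    (hx2 : avg n (fun j : 'Z_n => x j ^+ 2) = 1) :
  dirichlet n x >=
    2 * spectral_gap R n / 3
      * avg n (fun j : 'Z_n => (x j - 1) ^+ 2 * (x j + 2)).
Proof.
have n1 : (1 < n)%N by rewrite (leq_trans _ hn).
have cubic_ge0 : 0 <= avg n (fun j : 'Z_n => (x j - 1) ^+ 2 * (x j + 2)).
  by apply: avg_ge0 => j; rewrite mulr_ge0 ?sqr_ge0// addr_ge0.
have gap : spectral_gap R n <= 1 - cos (turn R n) by apply: spectral_gap_le; lia.
apply: (@le_trans _ _ (2 * (1 - cos (turn R n)) / 3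
    * avg n (fun j : 'Z_n => (x j - 1) ^+ 2 * (x j + 2)))).
  by apply: ler_wpM2r => //; apply: ler_wpM2r; rewrite ?invr_ge0// ler_wpM2l.
have -> : avg n (fun j : 'Z_n => (x j - 1) ^+ 2 * (x j + 2))
    = avg n (fun j => x j ^+ 3) - 3 * avg n x + 2.
  rewrite -[in RHS](avg_cst R n 2 n1) -mulNr -avgZ -!avgD.
  by apply: eq_avg => j; ring.
have mean_ge0 : 0 <= avg n x by exact: avg_ge0.
move: hn; rewrite leq_eqVlt => /predU1P[n4|n4]; last exact: cubic_le_dirichlet.
case: n / n4 x hx0 hx2 n1 cubic_ge0 gap mean_ge0 => x hx0 hx2 n1 _ _ mean_ge0.
have -> : cos (turn R 4) = 0.
  by rewrite -[RHS](cos_pihalf R); congr cos; rewrite /turn -mulr_natr; field.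
by rewrite subr0 mulr1; exact: cubic_le_dirichlet4.
Qed.
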